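(* Every upcycle has the partial words run property. That is, if $u$ is an upcycle for $A^n$ with diamondicity $d$ and $a=|A|$, then for every $r\in\{1,\dots,n\}$ and every letter $\ell\in A$, the number of $\ell^r$ runs in $u$, i.e. $E(u,\ell^r)$, equals $a^{n-d-r}$.
   Context: Let $A$ be an alphabet with $a=|A|\ge 2$ letters and $\diamond\notin A$ a wildcard symbol (''diamond''). A partial word is a finite sequence over $A\cup\{\diamond\}$; a cyclic partial word $u=(u_1\cdots u_N)$ is cyclically ordered, with indices taken modulo $N$, and $|u|=N$. A partial word $x$ covers a word $y$ of the same length if for each $i$ either $x_i=\diamond$ or $x_i=y_i$. For $n\ge 1$, an upcycle for $A^n$ is a cyclic partial word $u=(u_1\cdots u_N)$ such that for each word $y\in A^n$ there is exactly one position $i\in\{1,\dots,N\}$ such that the window $u_i\cdots u_{i+n-1}$ covers $y$. It is known that the diamonds of an upcycle are $n$-periodic ($u_i=\diamond$ implies $u_{i+n}=\diamond$), so all windows contain the same number $d$ of diamonds, called the diamondicity. Expected multiplicity: for a cyclic partial word $u$ and a word $w$ over $A$, let $\mathcal{C}(u,w,q)$ be the multiset of windows $u_iu_{i+1}\cdots u_{i+|w|-1}$, $1\le i\le|u|$, that cover $w$ and contain exactly $q$ diamonds. Then $E(u,w)=\sum_{q\ge 0}|\mathcal{C}(u,w,q)|/a^q$. For a letter $\ell$ and $r\ge 1$, $\ell^r$ is the word consisting of $r$ copies of $\ell$, and the number of $\ell^r$ runs in $u$ is defined to be $E(u,\ell^r)$ (possibly non-integral). *)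

(* Defs.v *)
From HB Require Import structures.
From mathcomp Require Import all_boot all_order all_algebra.

Set Implicit Arguments.
Unset Strict Implicit.
Unset Printing Implicit Defensive.

Import Order.TTheory GRing.Theory Num.Theory.

Section PartialWords.
Variable A : finType.

(* A partial word over A is a [seq (option A)]; [None] is the diamond. *)
Implicit Types (u x : seq (option A)) (y w : seq A).

Definition covers_letter (o : option A) (c : A) : bool :=
  (o == None) || (o == Some c).

(* [all2] is false on sequences of different sizes. *)
Definition covers x y : bool := all2 covers_letter x y.

Definition diamonds x : nat := count (pred1 None) x.

(* A cyclic partial word is given by the list of its letters read from a base
   position; positions are the i < size u, counted from 0.  A window may be
   longer than u, in which case it wraps around several times. *)
Definition cyc u (i : nat) : option A := nth None u (i %% size u).

Definition window u (i m : nat) : seq (option A) :=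
  mkseq (fun j => cyc u (i + j)) m.

Definition upcycle (n : nat) u : Prop :=
  forall y : n.-tuple A, exists! i : 'I_(size u), covers (window u i n) y.

(* For an upcycle any window gives the same value: see [upcycle_diamonds]. *)
Definition diamondicity (n : nat) u : nat := diamonds (window u 0 n).

(* The multiset C(u, w, q), as a list. *)
Definition covering_windows u w (q : nat) : seq (seq (option A)) :=
  [seq x <- [seq window u i (size w) | i <- iota 0 (size u)]
     | covers x w & diamonds x == q].

(* The sum over all q >= 0 stops at size w, since a window of length size w
   has at most size w diamonds. *)
Definition expected_multiplicity u w : rat :=
  (\sum_(q < (size w).+1)
     (size (covering_windows u w q))%:R / #|A|%:R ^+ q)%R.

Definition num_runs u (l : A) (r : nat) : rat :=
  expected_multiplicity u (nseq r l).

#[local] Arguments window : simpl never.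
#[local] Arguments covers : simpl never.

Lemma cyc_addr u i : cyc u (i + size u) = cyc u i.
Proof. by rewrite /cyc modnDr. Qed.

Lemma window_addr u i m : window u (i + size u) m = window u i m.
Proof. by apply: eq_map => j; rewrite addnAC cyc_addr. Qed.

Lemma windowSl u i m : window u i m.+1 = cyc u i :: window u i.+1 m.
Proof.
rewrite /window /mkseq /= addn0 -[1]/(1 + 0) iotaDl -map_comp.
by congr (_ :: _); apply: eq_map => j /=; rewrite add1n addnS addSn.
Qed.

Lemma windowSr u i m : window u i m.+1 = rcons (window u i m) (cyc u (i + m)).
Proof. by rewrite /window /mkseq -addn1 iotaD map_cat cats1. Qed.

Lemma covers_rcons x o y c : size x = size y ->
  covers (rcons x o) (rcons y c) = covers x y && covers_letter o c.
Proof.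
rewrite /covers !all2E !size_rcons eqSS => Exy.
by rewrite Exy eqxx zip_rcons // all_rcons /= andbC.
Qed.

Lemma upcycle_card n u (y : n.-tuple A) : upcycle n u ->
  \sum_(i < size u) covers (window u i n) y = 1.
Proof.
case/(_ y) => i [ci ui]; rewrite (bigD1 i) //= ci big1 // => j ji.
by apply/eqP; rewrite eqb0; apply/negP=> /ui ij; rewrite ij eqxx in ji.
Qed.

Let wt (o : option A) := \sum_(c : A) covers_letter o c.

Let wtE o : wt o = if o == None then #|A| else 1.
Proof.
rewrite /wt /covers_letter; case: o => [d|] /=; last by rewrite sum1_card.
rewrite (bigD1 d) //= eqxx big1 // => c cd.
by apply/eqP; rewrite eqb0; apply: contra cd => /eqP [->].
Qed.

Lemma upcycle_sumr m u (v : m.-tuple A) : upcycle m.+1 u ->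
  \sum_(i < size u) covers (window u i m) v * wt (cyc u (i + m)) = #|A|.
Proof.
move=> Hu; transitivity (\sum_(c : A) 1); last by rewrite sum1_card.
under [RHS]eq_bigr => c _ do rewrite -(upcycle_card [tuple of rcons v c] Hu).
rewrite exchange_big /=; apply: eq_bigr => i _; rewrite /wt big_distrr /=.
apply: eq_bigr => c _.
by rewrite windowSr covers_rcons ?size_mkseq ?size_tuple // mulnb.
Qed.

Lemma upcycle_suml m u (v : m.-tuple A) : upcycle m.+1 u ->
  \sum_(i < size u) covers (window u i m) v * wt (cyc u (i + size u).-1)
  = #|A|.
Proof.
move=> Hu; transitivity (\sum_(c : A) 1); last by rewrite sum1_card.
under [RHS]eq_bigr => c _ do rewrite -(upcycle_card [tuple of c :: v] Hu).
rewrite exchange_big /=.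
transitivity (\sum_(i < size u) covers (window u i.+1 m) v * wt (cyc u i)).
  pose G i := covers (window u i m) v * wt (cyc u (i + size u).-1).
  have GS i : covers (window u i.+1 m) v * wt (cyc u i) = G i.+1.
    by rewrite /G addSn /= cyc_addr.
  under [RHS]eq_bigr => i _ do rewrite GS.
  have GN : G (size u) = G 0.
    rewrite /G -[in window _ (size u)](add0n (size u)) window_addr add0n.
    case: (posnP (size u)) => [->//|Npos].
    have -> : (size u + size u).-1 = (size u).-1 + size u.
      by rewrite -[in RHS]subn1 addnBAC // subn1.
    by rewrite cyc_addr.
  rewrite -(big_mkord xpredT G) -(big_mkord xpredT (G \o S)) /=.
  case: (size u) GN => [|k] GN; first by rewrite !big_geq.
  by rewrite [RHS]big_nat_recr // [LHS]big_nat_recl //= GN addnC.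
apply: eq_bigr => i _; rewrite /wt big_distrr /=.
by apply: eq_bigr => c _; rewrite windowSl /covers /= andbC mulnb.
Qed.

Lemma upcycle_periodic n u i : 1 < #|A| -> 0 < n -> upcycle n u ->
  (cyc u (i + n) == None) = (cyc u i == None).
Proof.
case: n => // m a_gt1 _ Hu; have /card_gt0P[a0 _] := ltnW a_gt1.
have Npos : 0 < size u.
  by have [k _] := Hu [tuple of nseq m.+1 a0]; exact: leq_ltn_trans (leq0n k) (ltn_ord k).
have Hx x : covers x (map (odflt a0) x).
  by rewrite /covers; elim: x => [|[c|] x IH] //=; rewrite /covers_letter /= ?eqxx.
pose j := Ordinal (ltn_pmod i.+1 Npos).
have Ej k : cyc u (j + k) = cyc u (i.+1 + k) by rewrite /cyc /= modnDml.
have szv : size (map (odflt a0) (window u j m)) == m.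
  by rewrite size_map size_mkseq.
have Er := upcycle_sumr (Tuple szv) Hu.
have El := upcycle_suml (Tuple szv) Hu.
have key F1 F2 : \sum_(k < size u) covers (window u k m) (Tuple szv) * wt (F1 k)
      = #|A| ->
    \sum_(k < size u) covers (window u k m) (Tuple szv) * wt (F2 k) = #|A| ->
    F1 j = None -> F2 j = None.
  rewrite (bigD1 j) //= Hx mul1n => E1; rewrite (bigD1 j) //= Hx mul1n => E2 F1N.
  move: E1; rewrite F1N wtE eqxx -[RHS]addn0 => /addnI E1.
  have E0 k : k != j ->
      covers (window u k m) (map (odflt a0) (window u j m)) = false.
    move=> kj; move/eqP: E1; rewrite sum_nat_eq0 => /forall_inP/(_ k kj).
    rewrite muln_eq0 eqb0 => /orP[/negbTE//|]; rewrite wtE.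
    by case: ifP => //; rewrite (gtn_eqF (ltnW a_gt1)).
  move: E2; rewrite big1 ?addn0 => [|k kj]; last by rewrite E0.
  by rewrite wtE; case: eqP => // _ E; rewrite -E in a_gt1.
have ER : cyc u (j + m) = cyc u (i + m.+1) by rewrite Ej addSnnS.
have EL : cyc u (j + size u).-1 = cyc u i.
  have -> : (j + size u).-1 = j + (size u).-1 by rewrite -!subn1 addnBA.
  by rewrite Ej addSnnS prednK // cyc_addr.
apply/eqP/eqP; rewrite -ER -EL.
  exact: (key (fun k => cyc u (k + m)) (fun k => cyc u (k + size u).-1)).
exact: (key (fun k => cyc u (k + size u).-1) (fun k => cyc u (k + m))).
Qed.

Lemma upcycle_diamonds n u i : 1 < #|A| -> 0 < n -> upcycle n u ->
  diamonds (window u i n) = diamondicity n u.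
Proof.
move=> a_gt1 n_gt0 Hu; elim: i => // i <-.
case: n => // m in n_gt0 Hu *; rewrite windowSr windowSl /diamonds.
by rewrite -cats1 count_cat /= addn0 addnC addSnnS upcycle_periodic.
Qed.

End PartialWords.

(* Main.v *)
Require Import Defs.
From mathcomp Require Import all_boot all_order all_algebra.
Import Order.TTheory GRing.Theory Num.Theory.
Local Open Scope ring_scope.

(** For every word [w] one has E(u, w) = \sum_c E(u, wc): a window covering [w]
    that is followed by a letter extends to cover exactly one [wc] with the same
    weight, and one followed by a diamond extends to all [a] of them, each with
    weight divided by [a]. Starting from words of length [n], which are covered
    exactly once and by a window with [d] diamonds, so that E(u, w) = a^(-d),
    descending induction gives E(u, w) = a^(n-d-|w|) for every word [w] of
    length at most [n]. *)

Lemma expected_multiplicityE (A : finType) (u : seq (option A)) (w : seq A) :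
  expected_multiplicity u w =
    \sum_(i < size u) (covers (window u i (size w)) w)%:R
      / #|A|%:R ^+ diamonds (window u i (size w)).
Proof.
rewrite /expected_multiplicity.
under eq_bigr => q _ do
  rewrite size_filter count_map -sum1_count big_mkcond natr_sum mulr_suml
    -[in iota 0 _](subn0 (size u)) big_mkord.
rewrite exchange_big; apply: eq_bigr => i _.
set x := window u i _.
(* After the exchange of sums, position [i] contributes only at [q = diamonds x]; this bound puts
   that value in the range of [q]. *)
have x_le : (diamonds x < (size w).+1)%N.
  by rewrite ltnS -[leqRHS](size_mkseq (fun j => cyc u (i + j))) count_size.
rewrite (bigD1 (Ordinal x_le)) //= eqxx andbT big1 ?addr0; first by case: covers.
move=> q; rewrite -val_eqE eq_sym /= => /negbTE ->.
by rewrite andbF mul0r.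
Qed.

Lemma sum_covers_letter (A : finType) (o : option A) : (0 < #|A|)%N ->
  \sum_(c : A) ((covers_letter o c)%:R / #|A|%:R ^+ (o == None) : rat) = 1.
Proof.
move=> A_gt0; case: o => [b|]; rewrite /covers_letter /=.
  rewrite (bigD1 b) //= eqxx divr1 big1 ?addr0 // => c cb.
  by rewrite divr1 (inj_eq Some_inj) eq_sym (negbTE cb).
by rewrite sumr_const -[LHS]mulr_natr mul1r mulVf // pnatr_eq0 -lt0n.
Qed.

Lemma expected_multiplicity_rcons (A : finType) (u : seq (option A))
    (w : seq A) : (0 < #|A|)%N ->
  expected_multiplicity u w =
    \sum_(c : A) expected_multiplicity u (rcons w c).
Proof.
move=> A_gt0; rewrite expected_multiplicityE.
under [RHS]eq_bigr => c _ do rewrite expected_multiplicityE size_rcons.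
rewrite exchange_big; apply: eq_bigr => i _.
(* A factor 1 is expanded as the sum over [c] of the weight with which the symbol right after the
   window covers [c]. *)
rewrite -[LHS]mulr1 -[X in _ * X = _](sum_covers_letter _ (cyc u (i + size w)) A_gt0)
  mulr_sumr.
apply: eq_bigr => c _; rewrite windowSr covers_rcons ?size_mkseq //.
rewrite /diamonds -cats1 count_cat /= addn0 -mulnb natrM exprD invfM.
by rewrite mulrACA.
Qed.

Lemma upcycle_expected_multiplicity (A : finType) (n : nat)
    (u : seq (option A)) (w : seq A) (k : nat) :
  (1 < #|A|)%N -> (0 < n)%N -> upcycle n u -> (size w + k)%N = n ->
  expected_multiplicity u w = #|A|%:R ^+ k / #|A|%:R ^+ diamondicity n u.
Proof.
move=> A_gt1 n_gt0 Hu; elim: k w => [|k IH] w.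
  rewrite addn0 => /eqP sz_w; rewrite expected_multiplicityE (eqP sz_w).
  (* All windows of length [n] have equally many diamonds, so the weight factors out and the number
     of windows covering [w], namely 1, remains. *)
  under eq_bigr => i _ do rewrite (upcycle_diamonds _ A_gt1 n_gt0 Hu).
  by rewrite -mulr_suml -natr_sum (upcycle_card (Tuple sz_w) Hu).
move=> sz_w; rewrite expected_multiplicity_rcons ?(ltnW A_gt1) //.
under eq_bigr => c _ do rewrite IH ?size_rcons ?addSnnS //.
by rewrite sumr_const -[LHS]mulr_natl exprS mulrA.
Qed.

Theorem theorem7p14 (A : finType) (n : nat) (u : seq (option A))
    (card_A : (2 <= #|A|)%N) (n_ge1 : (1 <= n)%N) (upcycle_u : upcycle n u)
    (r : nat) (r_bounds : (1 <= r <= n)%N) (l : A) :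
  num_runs u l r =
    (#|A|%:R : rat) ^ (n%:Z - (diamondicity n u)%:Z - r%:Z).
Proof.
have /andP[_ r_le] := r_bounds.
have a_neq0 : #|A|%:R != 0 :> rat by rewrite pnatr_eq0 -lt0n ltnW.
rewrite /num_runs (@upcycle_expected_multiplicity _ n _ _ (n - r)) //; last first.
  by rewrite size_nseq subnKC.
(* The exponent is regrouped as [(n - r) - d]: [n - r] is a natural number, while the whole is
   negative once [r] exceeds [n - d]. *)
by rewrite addrAC subzn // expfzDr // exprnN.
Qed.
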